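(* Let $b>0$ and let $\alpha:[0,b]\to\mathbb{R}$ be a differentiable function with $0<\alpha(t)<1$ for all $t\in[0,b]$ and $|\alpha'(t)|\le L$ on $[0,b]$ for some constant $L$. Let $k(t)=t^{-\alpha(t)}$ for $t\in(0,b)$. Then the function $$K(t)=\frac{t^{\alpha(0)-1}}{\kappa},\qquad \kappa=\Gamma(\alpha(0))\,\Gamma(1-\alpha(0)),$$ where $\Gamma(\cdot)$ is the Gamma function, is an associated kernel of $k$ with which $k$ satisfies the generalized Sonine condition (gSC).
   Context: Let $b>0$. A real-valued kernel $k\in L^1(0,b)$ is said to satisfy the generalized Sonine condition (gSC) with associated kernel $K$ if $K\in L^1(0,b)$ and there is a function $g:[0,b]\to\mathbb{R}$, continuous on $[0,b]$ and differentiable on $(0,b)$, with $g'\in L^1(0,b)$ and $g(0)=1$, such that $$\int_0^t K(t-s)k(s)\,ds=g(t)\quad\text{for almost all } t\in(0,b).$$ *)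

(* Defs.v *)
From HB Require Import structures.
From mathcomp Require Import all_boot all_order all_algebra.
From mathcomp Require Import all_classical all_reals all_analysis.
Import Order.TTheory GRing.Theory Num.Theory.
Import numFieldNormedType.Exports.
Set Implicit Arguments.
Unset Strict Implicit.
Unset Printing Implicit Defensive.

Local Open Scope classical_set_scope.
Local Open Scope ring_scope.

(* Functions on an interval are total functions R -> R of which only the
   values on the interval in question are ever used. *)

(* [l] is the derivative at [x] of [f] restricted to [A]: at an endpoint of a
   closed interval [A] this is the one-sided derivative.  ([derivable f x 1]
   would also constrain the values of [f] outside [A].) *)
Definition is_derivative_within (R : realType) (A : set R) (f : R -> R)
    (x l : R) : Prop :=
  (f y - f x) / (y - x) @[y --> within A x^'] --> l.

Definition Gamma (R : realType) (x : R) : R :=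
  \int[@lebesgue_measure R]_(t in `]0, +oo[) (t `^ (x - 1) * expR (- t)).

(* [lebesgue_measure] lives on the Borel sets, so [f] is a Borel representative
   of its class. *)
Definition L1 (R : realType) (b : R) (f : R -> R) : Prop :=
  (@lebesgue_measure R).-integrable `]0, b[ (EFin \o f).

(* The convolution integral is the extended-real one, so that its equality
   with the finite number [g t] includes the integrability of
   [s |-> K (t - s) * k s] on (0, t). *)
Definition gSC (R : realType) (b : R) (k K : R -> R) : Prop :=
  [/\ L1 b k, L1 b K &
      exists g : R -> R,
        [/\ {within `[0, b], continuous g},
            forall t, t \in `]0, b[ -> derivable g t 1,
            L1 b (g^`()%classic),
            g 0 = 1 &
            {ae @lebesgue_measure R, forall t, t \in `]0, b[ ->
              (\int[@lebesgue_measure R]_(s in `]0%R, t[)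
                 (K (t - s) * k s)%:E = (g t)%:E)%E}]].

(* Main.v *)
Require Import Defs.
From HB Require Import structures.
From mathcomp Require Import all_boot all_order all_algebra.
From mathcomp Require Import ring lra.
From mathcomp Require Import all_classical all_reals all_analysis.
From mathcomp Require Import measurable_realfun.
Import Order.TTheory GRing.Theory Num.Theory.
Import numFieldNormedType.Exports.
Local Open Scope classical_set_scope.
Local Open Scope ring_scope.

(** Write [a = alpha 0] and factor the kernel as
    [k s = s `^ (- a) * H s] with [H s = s `^ (a - alpha s)]. Substituting
    [s = t * u] in the convolution of [k] with [s `^ (a - 1)] makes all powers of
    [t] cancel ([abel_convolution]) and leaves the average
      [G t = \int_(u in ]0, 1[) w u * H (t * u)],
      [w u = u `^ (- a) * (1 - u) `^ (a - 1)].
    Hence [g = G / kappa], provided that this [g] has the required regularity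
    and [G 0 = kappa].

    The value at [0]: [H 0 = 1], so [G 0] is the Beta integral of [w], and Euler's
    identity [egammaM] (Tonelli, then a translation and a dilation of Lebesgue
    measure) evaluates it as [Gamma a * Gamma (1 - a)] ([ebeta_reflection]). It
    also shows that [w] is integrable, since both Gamma integrals are finite, and
    that [kappa >= 1], since [w >= 1].

    The regularity: the mean value theorem gives [`|a - alpha s| <= L * s], so
    the exponent [(a - alpha s) * ln s] of [H] tends to [0] with [s] and the
    derivative of [H] is at most of the size of [ln s]. It suffices to
    know that this is [O((Num.sqrt s)^-1)], that is, that [H] is Lipschitz as a
    function of [Num.sqrt s] ([sqrt_lipschitz_order_defect]). This property passes
    from [H] to its dilates and to their average [G], which is therefore
    continuous. It also dominates the difference quotients uniformly, so [G] is
    differentiable under the integral sign, and it bounds the derivative of [G] by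
    a multiple of [(Num.sqrt t)^-1], which is integrable on [(0, b)]. *)

(** * Affine substitution for Lebesgue measure *)

Section affine_substitution.
Context {R : realType}.
Variables c d : R.
Hypothesis c0 : 0 < c.
Let phi : measurableTypeR R -> measurableTypeR R := fun x => (c * x + d)%R.

Let mphi : measurable_fun setT phi.
Proof. by apply: measurable_funD => //; exact: measurable_cst. Qed.

Let image_measure : {measure set (measurableTypeR R) -> \bar R}.
Proof.
refine (mscale (NngNum (ltW c0)) (pushforward (@lebesgue_measure R) phi)).
exact: mphi.
Defined.

(** Uniqueness of Lebesgue measure: the two measures agree on half-open
    intervals. *)
Let image_measureE (A : set R) : measurable A ->
  @lebesgue_measure R A = image_measure A.
Proof.
move=> mA.
apply: lebesgue_measure_unique => //= _ [[x y]] _ <- /=.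
rewrite /mscale /= /pushforward /=.
rewrite [X in _ = (_ * lebesgue_measure X)%E](_ : _ =
    `](x - d) / c, (y - d) / c]%classic); last first.
  apply/funext => z; rewrite /= !in_itv /= ltr_pdivrMr// ler_pdivlMr//.
  by rewrite (mulrC z) ltrBlDr lerBrDr.
rewrite !lebesgue_measure_itv /= !lte_fin ltr_pM2r ?invr_gt0// ltrD2r.
case: ifPn => _; last by rewrite mule0.
rewrite -EFinD -EFinM; congr EFin; field; exact: lt0r_neq0.
Qed.

(** For nonnegative integrands this holds with no continuity at the ends of
    [D], which is what the singular integrands below require. *)
Lemma ge0_integral_affine (D : set R) (f : R -> \bar R) :
  measurable D -> measurable_fun D f -> (forall x, D x -> (0 <= f x)%E) ->
  (\int[@lebesgue_measure R]_(x in D) f x =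
   c%:E * \int[@lebesgue_measure R]_(x in [set x | D (c * x + d)%R])
            f (c * x + d)%R)%E.
Proof.
move=> mD mf f0.
transitivity (\int[image_measure]_(x in D) f x)%E.
  by apply: eq_measure_integral => //= A mA _; exact: image_measureE.
rewrite ge0_integral_mscale//; congr (_ * _)%E.
by rewrite ge0_integral_pushforward// => x /set_mem; exact: f0.
Qed.

Corollary ge0_integral_affineT (f : R -> \bar R) :
  measurable_fun setT f -> (forall x, (0 <= f x)%E) ->
  (\int[@lebesgue_measure R]_x f x =
   c%:E * \int[@lebesgue_measure R]_x f (c * x + d)%R)%E.
Proof. by move=> mf f0; rewrite ge0_integral_affine. Qed.

End affine_substitution.

(** * Integrability of powers *)

Lemma integral_mul_indic (R : realType) (D : set R) (f : R -> R) :
  (\int[@lebesgue_measure R]_(x in D) (f x)%:E =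
   \int[@lebesgue_measure R]_x (f x * \1_D x)%:E)%E.
Proof.
rewrite integral_mkcond; apply: eq_integral => x _.
by rewrite patchE indicE; case: ifPn => _; rewrite ?mulr1 ?mulr0.
Qed.

(** The antiderivative [t `^ a / a] is used on the intervals [[b / (n + 2), b]],
    where the integrand is continuous; they increase to the whole interval. *)
Lemma integral_powR_le (R : realType) (a b : R) : 0 < a -> 0 < b ->
  (\int[@lebesgue_measure R]_(t in `]0%R, b[) (t `^ (a - 1))%:E <=
   (b `^ a / a)%:E)%E.
Proof.
move=> a0 b0.
have mp D : measurable_fun D (fun t : R => (t `^ (a - 1))%:E).
  by apply/measurable_EFinP/measurable_funTS; exact: measurable_powR.
(* [n.+2] and not [n.+1]: every [F n] has distinct endpoints. *)
pose F (n : nat) : set R := `[b / n.+2%:R, b]%classic.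
have Fpos n : 0 < b / n.+2%:R by rewrite divr_gt0.
have Flt n : b / n.+2%:R < b by rewrite ltr_pdivrMr// ltr_pMr// ltr1n.
have UF : `]0%R, b[ `<=` \bigcup_n F n.
  move=> x /=; rewrite in_itv/= => /andP[x0 xb].
  exists (Num.truncn (b / x)) => //; rewrite /F /= in_itv/= (ltW xb) andbT.
  rewrite ler_pdivrMr// mulrC -ler_pdivrMr//.
  apply: (le_trans (ltW (truncnS_gt _))).
  by rewrite ler_nat.
apply: (@le_trans _ _
    (\int[@lebesgue_measure R]_(t in \bigcup_n F n) (t `^ (a - 1))%:E)%E).
  apply: ge0_subset_integral => //; last 2 first.
  - exact: mp.
  - by move=> x _; rewrite lee_fin powR_ge0.
  by apply: bigcupT_measurable => n; exact: measurable_itv.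
have nndF : nondecreasing_seq F.
  move=> m n mn; rewrite subsetEset => x; rewrite /F /= !in_itv/=.
  move=> /andP[mx ->].
  rewrite andbT (le_trans _ mx)// ler_pM2l// lef_pV2 ?posrE// ler_nat.
  exact: mn.
have cvgF : (\int[@lebesgue_measure R]_(t in F n) (t `^ (a - 1))%:E)%E
    @[n --> \oo] -->
    (\int[@lebesgue_measure R]_(t in \bigcup_n F n) (t `^ (a - 1))%:E)%E.
  apply: ge0_nondecreasing_set_cvg_integral => //.
  - by move=> n; exact: measurable_itv.
  - by move=> n; exact: mp.
  - by move=> n x _; rewrite lee_fin powR_ge0.
rewrite -(cvg_lim _ cvgF)//.
apply: lime_le; first by apply/cvg_ex; eexists; exact: cvgF.
apply: nearW => n.
rewrite (@continuous_FTC2 _ _ (fun t => t `^ a / a))//.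
- by rewrite -EFinB lee_fin gerBl divr_ge0 ?powR_ge0 ?ltW.
- apply: continuous_in_subspaceT => x.
  rewrite inE/= in_itv/= => /andP[nx _].
  have x0 : 0 < x := lt_le_trans (Fpos n) nx.
  apply: differentiable_continuous; apply/derivable1_diffP.
  by apply: derivable_powR; rewrite in_itv/= x0.
- have dF x : 0 < x -> derivable (fun t : R => t `^ a / a) x 1.
    move=> x0; apply: derivableM => //.
    by apply: derivable_powR; rewrite in_itv/= x0.
  have cF x : 0 < x -> {for x, continuous (fun t : R => t `^ a / a)}.
    by move=> x0; apply/differentiable_continuous/derivable1_diffP/dF.
  split.
  + move=> x; rewrite in_itv/= => /andP[nx _].
    exact/dF/(lt_trans (Fpos n)).
  + by apply: cvg_at_right_filter; apply: cF.
  + by apply: cvg_at_left_filter; apply: cF.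
- move=> x; rewrite in_itv/= => /andP[nx _].
  have x0 : 0 < x := lt_trans (Fpos n) nx.
  rewrite derive1Mr; last by apply: derivable_powR; rewrite in_itv/= x0.
  rewrite powR_derive1 ?in_itv/= ?x0//.
  by rewrite mulrAC divff ?mul1r// gt_eqF.
Qed.

Lemma integrable_powR (R : realType) (a b : R) : 0 < a -> 0 < b ->
  (@lebesgue_measure R).-integrable `]0, b[ (fun t => (t `^ (a - 1))%:E).
Proof.
move=> a0 b0; apply/integrableP; split.
  by apply/measurable_EFinP/measurable_funTS; exact: measurable_powR.
apply: le_lt_trans (ltry (b `^ a / a)).
under eq_integral do rewrite gee0_abs ?lee_fin ?powR_ge0//.
exact: integral_powR_le.
Qed.

(** * The Gamma and Beta integrals *)

Section euler_integrals.
Context {R : realType}.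
Local Notation mu := (@lebesgue_measure R).

(** Extended-real valued, so that Tonelli's theorem applies before anything is
    known to be finite. *)
Definition egamma (a : R) : \bar R :=
  (\int[mu]_(t in `]0%R, +oo[) (t `^ (a - 1) * expR (- t))%:E)%E.

Definition ebeta (a b : R) : \bar R :=
  (\int[mu]_(u in `]0%R, 1%R[) (u `^ (a - 1) * (1 - u) `^ (b - 1))%:E)%E.

(** Powers cut off at [0] turn integrals over half-lines and bounded intervals
    into integrals over the whole line, where translations act. *)
Let pw (r x : R) : R := x `^ r * \1_`]0, +oo[ x.

Let pw_ge0 r x : 0 <= pw r x.
Proof. by rewrite mulr_ge0 ?powR_ge0. Qed.

Let pwE r x : 0 < x -> pw r x = x `^ r.
Proof. by move=> x0; rewrite /pw indicE mem_set ?mulr1//= in_itv/= x0. Qed.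

Let pw0 r x : x <= 0 -> pw r x = 0.
Proof.
move=> x0; rewrite /pw indicE memNset ?mulr0//= in_itv/= andbT.
by apply/negP; rewrite -leNgt.
Qed.

Let measurable_pw r : measurable_fun setT (pw r).
Proof.
by apply: measurable_funM; [exact: measurable_powR|exact: measurable_indic].
Qed.

Let measurable_pwexp r : measurable_fun setT (fun x => pw r x * expR (- x)).
Proof.
apply: measurable_funM => //.
by apply: measurableT_comp; [exact: measurable_expR|exact: oppr_measurable].
Qed.

Let measurable_pw_pw r r' z :
  measurable_fun setT (fun x => (pw r x * pw r' (z - x))%:E).
Proof.
apply/measurable_EFinP; apply: measurable_funM => //.
by apply: measurableT_comp => //; exact: measurable_funB.
Qed.

Let egammaE a : (egamma a = \int[mu]_t (pw (a - 1) t * expR (- t))%:E)%E.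
Proof.
rewrite /egamma integral_mul_indic; apply: eq_integral => x _.
by rewrite /pw mulrAC.
Qed.

Let ebetaE a b :
  (ebeta a b = \int[mu]_u (pw (a - 1) u * pw (b - 1) (1 - u))%:E)%E.
Proof.
rewrite /ebeta integral_mul_indic; apply: eq_integral => x _; congr EFin.
have [x0|x0] := leP x 0.
  rewrite pw0// mul0r indicE memNset ?mulr0//= in_itv/= => /andP[].
  by rewrite ltNge x0.
have [x1|x1] := leP 1 x.
  rewrite [pw (b - 1) _]pw0 ?subr_le0// mulr0 indicE memNset ?mulr0//=.
  by rewrite in_itv/= => /andP[_]; rewrite ltNge x1.
by rewrite !pwE ?subr_gt0// indicE mem_set ?mulr1//= in_itv/= x0 x1.
Qed.

Lemma egamma_ge0 a : (0 <= egamma a)%E.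
Proof.
by apply: integral_ge0 => x _; rewrite lee_fin mulr_ge0 ?powR_ge0 ?expR_ge0.
Qed.

Lemma ebeta_ge0 a b : (0 <= ebeta a b)%E.
Proof.
by apply: integral_ge0 => x _; rewrite lee_fin mulr_ge0 ?powR_ge0.
Qed.

Lemma GammaE (a : R) : Gamma a = fine (egamma a).
Proof. by []. Qed.

(** The convolution of two cut-off powers is a multiple of a cut-off power:
    substitute [x = z * u]; the factor [z] from the measure and the two powers
    of [z] combine into [z `^ (a + b - 1)]. *)
Let convolution_pw a b z :
  (\int[mu]_x (pw (a - 1) x * pw (b - 1) (z - x))%:E =
   (pw (a + b - 1) z)%:E * ebeta a b)%E.
Proof.
have [z0|z0] := leP z 0.
  rewrite pw0// mul0e integral0_eq// => x _; congr EFin.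
  have [x0|x0] := leP x 0; first by rewrite pw0 ?mul0r.
  by rewrite [X in _ * X]pw0 ?mulr0// subr_le0 (le_trans z0)// ltW.
rewrite (ge0_integral_affineT z 0 z0)//; last first.
  by move=> x; rewrite lee_fin mulr_ge0.
rewrite ebetaE.
transitivity (z%:E * \int[mu]_u ((z `^ (a - 1) * z `^ (b - 1))%:E *
    (pw (a - 1) u * pw (b - 1) (1 - u))%:E))%E.
  congr (_ * _)%E; apply: eq_integral => u _.
  rewrite -EFinM; congr EFin; rewrite addr0.
  have -> : z - z * u = z * (1 - u) by rewrite mulrBr mulr1.
  have [u0|u0] := leP u 0.
    by rewrite [pw _ (z * u)]pw0 ?pmulr_rle0// [pw _ u]pw0// !mul0r mulr0.
  have [u1|u1] := leP 1 u.
    rewrite [pw _ (z * (1 - u))]pw0 ?pmulr_rle0 ?subr_le0//.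
    by rewrite [pw _ (1 - u)]pw0 ?subr_le0// !mulr0.
  rewrite !pwE ?mulr_gt0 ?subr_gt0//.
  by rewrite !powRM ?(ltW z0) ?(ltW u0) ?subr_ge0 ?(ltW u1)// mulrACA.
rewrite ge0_integralZl//; last 3 first.
- exact: measurable_pw_pw.
- by move=> x _; rewrite lee_fin mulr_ge0.
- by rewrite lee_fin mulr_ge0 ?powR_ge0.
rewrite muleA -EFinM; congr (_%:E * _)%E.
rewrite pwE// -[X in X * _](powRr1 (ltW z0)) -!powRD ?(gt_eqF z0) ?implybT//.
by congr (_ `^ _); ring.
Qed.

(** Euler's identity. The product is the integral of
    [x `^ (a - 1) * y `^ (b - 1) * expR (- (x + y))] over a quadrant; in the
    variables [x] and [z = x + y] the inner integral is a convolution of powers.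
    Tonelli makes the identity valid in the extended reals for all exponents. *)
Lemma egammaM (a b : R) :
  (egamma a * egamma b = egamma (a + b) * ebeta a b)%E.
Proof.
pose f (xz : R * R) :=
  (pw (a - 1) xz.1 * pw (b - 1) (xz.2 - xz.1) * expR (- xz.2))%:E.
have mf : measurable_fun setT f.
  apply/measurable_EFinP; apply: measurable_funM; first apply: measurable_funM.
  - by apply: measurableT_comp => //; exact: measurable_fst.
  - apply: measurableT_comp => //.
    by apply: measurable_funB; [exact: measurable_snd|exact: measurable_fst].
  - apply: measurableT_comp; first exact: measurable_expR.
    by apply: measurableT_comp => //; exact: measurable_snd.
have f0 xz : (0 <= f xz)%E by rewrite lee_fin mulr_ge0 ?expR_ge0// mulr_ge0.
transitivity (\int[mu]_x \int[mu]_z f (x, z))%E.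
  rewrite [X in (X * _)%E]egammaE -ge0_integralZr ?egamma_ge0//; last 2 first.
  - by apply/measurable_EFinP; exact: measurable_pwexp.
  - by move=> x _; rewrite lee_fin mulr_ge0 ?expR_ge0.
  apply: eq_integral => x _.
  rewrite egammaE (ge0_integral_affineT 1 (- x))//; last 2 first.
  - by apply/measurable_EFinP; exact: measurable_pwexp.
  - by move=> z; rewrite lee_fin mulr_ge0 ?expR_ge0.
  rewrite mul1e -ge0_integralZl//; last 3 first.
  - apply/measurable_EFinP.
    apply: (@measurableT_comp _ _ _ _ _ _
      (fun y => pw (b - 1) y * expR (- y))) => //.
    by apply: measurable_funD => //.
  - by move=> z _; rewrite lee_fin mulr_ge0 ?expR_ge0.
  - by rewrite lee_fin mulr_ge0 ?expR_ge0.
  apply: eq_integral => z _; rewrite /f -EFinM mul1r; congr EFin.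
  have -> : expR (- z) = expR (- x) * expR (- (z - x)).
    by rewrite -expRD; congr expR; ring.
  by rewrite /=; ring.
rewrite fubini_tonelli//.
rewrite [X in (X * _)%E]egammaE -ge0_integralZr ?ebeta_ge0//; last 2 first.
- by apply/measurable_EFinP; exact: measurable_pwexp.
- by move=> x _; rewrite lee_fin mulr_ge0 ?expR_ge0.
apply: eq_integral => z _.
rewrite EFinM muleAC -convolution_pw -ge0_integralZr ?lee_fin ?expR_ge0//;
  last 2 first.
- exact: measurable_pw_pw.
- by move=> x _; rewrite lee_fin mulr_ge0.
Qed.

Lemma egamma1 : egamma 1 = 1%E.
Proof.
rewrite /egamma integral_itv_obnd_cbnd; last first.
  apply/measurable_EFinP/measurable_funTS/measurable_funM.
    exact: measurable_powR.
  by apply: measurableT_comp; [exact: measurable_expR|exact: oppr_measurable].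
rewrite integral_mul_indic -(integral_exponential_pdf (ltr01 : (0 < 1 :> R))).
apply: eq_integral => x _; congr EFin.
rewrite /exponential_pdf patchE indicE subrr powRr0 mul1r.
by case: ifPn => _; rewrite ?mulr0// mulr1 mul1r mulN1r.
Qed.

(** The integrand is at most [t `^ (a - 1)] below [1], and at most [expR (- t)]
    above [1] because [a <= 1]. *)
Lemma egamma_fin_num (a : R) : 0 < a <= 1 -> egamma a \is a fin_num.
Proof.
move=> /andP[a0 a1]; rewrite ge0_fin_numE ?egamma_ge0//.
have mp : measurable_fun setT
    (fun t : R => (t `^ (a - 1) * \1_`]0, 1[ t)%:E).
  apply/measurable_EFinP/measurable_funM; first exact: measurable_powR.
  exact: measurable_indic.
apply: (@le_lt_trans _ _ (\int[mu]_(t in `]0%R, 1%R[) (t `^ (a - 1))%:E +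
  egamma 1)%E).
  rewrite integral_mul_indic !egammaE -ge0_integralD//; last 3 first.
  - by move=> x _; rewrite lee_fin mulr_ge0 ?powR_ge0.
  - by move=> x _; rewrite lee_fin mulr_ge0 ?expR_ge0.
  - by apply/measurable_EFinP; exact: measurable_pwexp.
  apply: ge0_le_integral => //.
  - by move=> x _; rewrite lee_fin mulr_ge0 ?expR_ge0.
  - by apply/measurable_EFinP; exact: measurable_pwexp.
  - apply: emeasurable_funD => //.
    by apply/measurable_EFinP; exact: measurable_pwexp.
  move=> x _; rewrite -EFinD lee_fin.
  have [x0|x0] := leP x 0; first by
    rewrite !pw0// !mul0r addr0 mulr_ge0 ?powR_ge0.
  rewrite !pwE// subrr powRr0 mul1r.
  have [x1|x1] := ltP x 1.
    rewrite indicE mem_set ?mulr1/= ?in_itv/= ?x0 ?x1//.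
    rewrite ler_wpDr ?expR_ge0// ler_piMr ?powR_ge0// expR_le1.
    by rewrite oppr_le0 ltW.
  rewrite ler_wpDl ?mulr_ge0 ?powR_ge0// ler_piMl ?expR_ge0//.
  by rewrite -[leRHS](powRr0 x) ler_powR// subr_le0.
rewrite egamma1 lte_add_pinfty ?ltry//.
have H := integral_powR_le R a 1 a0 ltr01.
apply: le_lt_trans H _.
exact: ltry.
Qed.

(** Both exponents are nonpositive, so the integrand is at least [1]. *)
Lemma ebeta_ge1 (a b : R) : a <= 1 -> b <= 1 -> (1 <= ebeta a b)%E.
Proof.
move=> a1 b1.
have <- : (\int[mu]_(u in `]0%R, 1%R[) (1 : R)%:E = 1)%E.
  rewrite integral_cst//= lebesgue_measure_itv/= lte_fin ltr01.
  by rewrite oppr0 adde0 mule1.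
apply: ge0_le_integral => //.
- apply/measurable_EFinP/measurable_funM; apply: measurable_funTS.
    exact: measurable_powR.
  apply: (@measurableT_comp _ _ _ _ _ _ (fun y : R => y `^ (b - 1))).
    exact: measurable_powR.
  exact: measurable_funB.
move=> x; rewrite /= in_itv/= => /andP[x0 x1]; rewrite lee_fin.
have ge1 (y r : R) : 0 < y < 1 -> r <= 1 -> 1 <= y `^ (r - 1).
  move=> /andP[y0 y1] r1; rewrite -[leLHS](powRr0 y).
  by apply: ger_powR; [rewrite y0 ltW|rewrite subr_le0].
by rewrite mulr_ege1 ?ge1 ?x0// subr_gt0 x1 ltrBlDr ltrDl.
Qed.

End euler_integrals.

(** * Functions Lipschitz in the square root, and averages of their dilates *)

Section sqrt_lipschitz.
Context {R : realType}.
Implicit Types (C t : R) (f : R -> R).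

(** Lipschitz continuity in the variable [Num.sqrt x]. Near [0] it allows a
    derivative as large as [C / Num.sqrt t], which is still integrable; and it is
    stable under the dilations [x |-> u * x] with [u >= 0]. As [Num.sqrt] vanishes on negative
    numbers, such a function is constant there. *)
Definition sqrt_lipschitz C f :=
  forall x y, `|f x - f y| <= C * `|Num.sqrt x - Num.sqrt y|.

Lemma sqrt_lipschitz_ge0 C f : sqrt_lipschitz C f -> 0 <= C.
Proof.
move=> Cf; have := Cf 1 0; rewrite sqrtr1 sqrtr0 subr0 normr1 mulr1.
exact: le_trans.
Qed.

Lemma dist_sqrt_le x y : 0 < y ->
  `|Num.sqrt x - Num.sqrt y| <= `|x - y| / Num.sqrt y :> R.
Proof.
move=> y0; rewrite ler_pdivlMr ?sqrtr_gt0//.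
have sy : Num.sqrt y ^+ 2 = y by rewrite sqr_sqrtr// ltW.
have [x0|x0] := leP 0 x.
  have sx : Num.sqrt x ^+ 2 = x by rewrite sqr_sqrtr.
  rewrite -[in leRHS]sx -[in leRHS]sy subr_sqr normrM ler_wpM2l//.
  by rewrite ger0_norm ?addr_ge0// lerDr.
rewrite ler0_sqrtr ?(ltW x0)// sub0r normrN ger0_norm// -expr2 sy.
rewrite ler0_norm; first by rewrite opprB lerBrDr gerDl ltW.
by rewrite subr_le0 ltW// (lt_trans x0).
Qed.

Lemma sqrt_lipschitz_continuous C f : sqrt_lipschitz C f -> continuous f.
Proof.
move=> Cf x.
have : C * `|Num.sqrt y - Num.sqrt x| @[y --> x] -->
    C * `|Num.sqrt x - Num.sqrt x|.
  apply: cvgMr; apply: cvg_norm.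
  apply: (cvgB (f := @Num.sqrt R) (g := fun=> Num.sqrt x)).
    exact: sqrt_continuous.
  exact: cvg_cst.
rewrite subrr normr0 mulr0 => B0.
apply/cvgrPdist_lt => e e0.
move/cvgrPdist_lt : B0 => /(_ _ e0); apply: filterS => y.
rewrite sub0r normrN distrC => /(le_lt_trans (ler_norm _)).
exact: le_lt_trans.
Qed.

Lemma sqrt_lipschitz_derive1 C f t : sqrt_lipschitz C f -> 0 < t ->
  derivable f t 1 -> `|f^`()%classic t| <= C / Num.sqrt t.
Proof.
move=> Cf t0 df; rewrite derive1E.
have nd : `|h^-1 *: (f (h *: 1 + t) - f t)| @[h --> 0^'] --> `|'D_1 f t|.
  exact: cvg_norm df.
apply: (cvgr_to_le nd).
near=> h.
have h0 : h != 0 by near: h; exact: nbhs_dnbhs_neq.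
rewrite normrM normfV ler_pdivrMl ?normr_gt0//.
rewrite -[X in f (X + _)]/(h * 1) mulr1 (le_trans (Cf _ _))//.
rewrite mulrCA ler_wpM2l ?(sqrt_lipschitz_ge0 _ _ Cf)//.
by rewrite (le_trans (dist_sqrt_le _ _ t0))// addrK.
Unshelve. all: by end_near. Qed.

(** The derivative is the pointwise limit of the difference quotients with
    steps [1 / (n + 1)]. *)
Lemma measurable_derive1 (D : set R) f : measurable D ->
  measurable_fun setT f -> (forall t, D t -> derivable f t 1) ->
  measurable_fun D (f^`()%classic).
Proof.
move=> mD mf df.
pose e : nat -> R := harmonic.
pose q (n : nat) (t : R) := (e n)^-1 * (f (e n + t) - f t).
apply: (@measurable_fun_cvg _ _ _ _ q).
  move=> n; apply: measurable_funTS; apply: measurable_funM => //.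
  apply: measurable_funB => //; apply: measurableT_comp => //.
  exact: measurable_funD.
move=> t Dt; have /cvgr_dnbhsP := df _ Dt.
move=> /(_ e) ce; rewrite derive1E.
have {}ce := ce (conj (fun n => lt0r_neq0 (harmonic_gt0 n)) cvg_harmonic).
apply: cvg_trans ce; apply: near_eq_cvg; apply: nearW => n.
by rewrite /q [e n *: 1]mulr1.
Qed.

End sqrt_lipschitz.

Lemma integrable_mul_bounded (R : realType) (D : set R) (w h : R -> R) (M : R) :
  measurable D -> (@lebesgue_measure R).-integrable D (EFin \o w) ->
  measurable_fun D h -> (forall x, D x -> `|h x| <= M) ->
  (@lebesgue_measure R).-integrable D (EFin \o (fun x => w x * h x)).
Proof.
move=> mD iw mh hM.
have -> : EFin \o (fun x => w x * h x) = ((EFin \o w) \* (EFin \o h))%E.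
  by apply/funext => x; rewrite /= EFinM.
apply: integrableMl => //; exists M; split; first exact: num_real.
by move=> K MK x Dx; exact: le_trans (hM _ Dx) (ltW MK).
Qed.

Lemma sqrt_lipschitzZ (R : realType) (c C : R) (f : R -> R) : 0 <= c ->
  sqrt_lipschitz C f -> sqrt_lipschitz (c * C) (fun t => c * f t).
Proof.
move=> c0 Cf x y; rewrite -mulrBr normrM ger0_norm// -mulrA.
by rewrite ler_wpM2l.
Qed.

(** The derivative is dominated by [C * t `^ (-1/2)]. *)
Lemma L1_derive1_sqrt_lipschitz (R : realType) (b C : R) (f : R -> R) : 0 < b ->
  sqrt_lipschitz C f -> (forall t, t \in `]0, b[ -> derivable f t 1) ->
  L1 b (f^`()%classic).
Proof.
move=> b0 Cf df.
have mf : measurable_fun `]0, b[ (f^`()%classic).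
  apply: measurable_derive1 => //.
  by apply: continuous_measurable_fun; exact: sqrt_lipschitz_continuous Cf.
have i2 : 0 < 2^-1 :> R by rewrite invr_gt0.
have ip : (@lebesgue_measure R).-integrable `]0, b[
    (EFin \o (fun t : R => t `^ (2^-1 - 1) * C)).
  apply: (integrable_mul_bounded _ _ _ _ `|C|) => //.
  exact: integrable_powR.
apply: le_integrable ip => //; first exact/measurable_EFinP.
move=> t tb; rewrite /= lee_fin.
have := tb; rewrite /= in_itv/= => /andP[t0 _].
apply: le_trans (sqrt_lipschitz_derive1 _ _ _ Cf t0 (df _ tb)) _.
rewrite (_ : 2^-1 - 1 = - 2^-1); last by lra.
rewrite powRN powR12_sqrt ?(ltW t0)// mulrC; exact: ler_norm.
Qed.

(** The convolution of the theorem becomes, after [s = t * u], an average of the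
    dilates [t |-> H (t * u)] of a single function, for [u] in [(0, 1)] and an
    integrable weight [w]. *)
Section averaged_dilations.
Context {R : realType}.
Local Notation mu := (@lebesgue_measure R).
Variables (w H : R -> R) (C : R).
Hypothesis w0 : forall u, 0 <= w u.
Hypothesis iw : mu.-integrable `]0, 1[ (EFin \o w).
Hypothesis CH : sqrt_lipschitz C H.

Definition averaged_dilations (t : R) : R :=
  \int[mu]_(u in `]0, 1[) (w u * H (t * u)).

Let C0 : 0 <= C := sqrt_lipschitz_ge0 _ _ CH.

Lemma sqrt_lipschitz_dilation u : 0 <= u <= 1 ->
  sqrt_lipschitz (w u * C) (fun t => w u * H (t * u)).
Proof.
move=> /andP[u0 u1] x y; rewrite -mulrBr normrM ger0_norm// -mulrA ler_wpM2l//.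
rewrite (le_trans (CH _ _))// ler_wpM2l//.
rewrite mulrC [y * u]mulrC !sqrtrM// -mulrBr normrM ger0_norm ?sqrtr_ge0//.
by rewrite ler_piMl// -sqrtr1 ler_wsqrtr.
Qed.

Lemma integrable_dilation t :
  mu.-integrable `]0, 1[ (EFin \o (fun u => w u * H (t * u))).
Proof.
apply: (integrable_mul_bounded _ _ _ _ (`|H 0| + C * Num.sqrt `|t|)) => //.
  apply: measurable_funTS; apply: measurableT_comp => //.
  by apply: continuous_measurable_fun; exact: sqrt_lipschitz_continuous CH.
move=> u /=; rewrite in_itv/= => /andP[u0 u1].
rewrite -[H (t * u)](subrK (H 0)) (le_trans (ler_normD _ _))// addrC lerD2l.
rewrite (le_trans (CH _ _))// ler_wpM2l// sqrtr0 subr0 ger0_norm ?sqrtr_ge0//.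
rewrite ler_wsqrtr// (le_trans (ler_norm _))// normrM ler_piMr//.
by rewrite ger0_norm ltW.
Qed.

Lemma sqrt_lipschitz_averaged_dilations :
  sqrt_lipschitz (\int[mu]_(u in `]0, 1[) w u * C) averaged_dilations.
Proof.
move=> t s; rewrite /averaged_dilations.
rewrite -RintegralB//; try exact: integrable_dilation.
have ifd : mu.-integrable `]0, 1[
    (EFin \o (fun u => w u * H (t * u) - w u * H (s * u))).
  have := integrableB _ (integrable_dilation t) (integrable_dilation s).
  move=> /(_ (measurable_itv _)); exact: eq_integrable.
apply: le_trans (le_normr_Rintegral _ _) _ => //.
rewrite -!mulrA -RintegralZr//; apply: le_Rintegral => //.
- exact: integrable_norm.
- exact: (integrable_mul_bounded _ _ _ _ `|_|).
move=> u; rewrite /= in_itv/= => /andP[u0 u1].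
by rewrite mulrA; apply: sqrt_lipschitz_dilation; rewrite !ltW.
Qed.

(** Differentiation under the integral sign: on [(t / 2, b)] the derivative of
    each dilate is at most [w u * (C / Num.sqrt (t / 2))], uniformly in the
    variable, because the modulus of continuity controls the derivative. *)
Lemma derivable_averaged_dilations (b t : R) :
  (forall s, s \in `]0, b[ -> derivable H s 1) -> t \in `]0, b[ ->
  derivable averaged_dilations t 1.
Proof.
move=> dH; rewrite in_itv/= => /andP[t0 tb].
have derH (x u : R) : x \in `]t / 2, b[ -> u \in `]0, 1[ ->
    derivable (fun x : R => w u * H (x * u)) x 1.
  rewrite !in_itv/= => /andP[tx xb] /andP[u0 u1].
  have x0 : 0 < x by rewrite (lt_trans _ tx)// divr_gt0.
  apply: derivableM => //.
  apply/derivable1_diffP/differentiable_comp => //.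
  apply/derivable1_diffP/dH; rewrite in_itv/= mulr_gt0//=.
  by rewrite (le_lt_trans _ xb)// ler_piMr// ltW.
apply: (@derivable_under_integral R _ _ mu (fun x u => w u * H (x * u))
  `]0, 1[ _ t (t / 2) b _ _ _ (fun u => w u * (C / Num.sqrt (t / 2)))) => //.
- by rewrite /= in_itv/= tb andbT ltr_pdivrMr// ltr_pMr// ltr1n.
- by move=> x _; exact: integrable_dilation.
- by move=> y; rewrite mulr_ge0// divr_ge0.
- exact: (integrable_mul_bounded _ _ _ _ `|_|).
move=> x u xI uI; rewrite /partial1of2.
move: (xI) (uI); rewrite /= !in_itv/= => /andP[tx xb] /andP[u0 u1].
have t20 : 0 < t / 2 by rewrite divr_gt0.
have x0 : 0 < x := lt_trans t20 tx.
have u01 : 0 <= u <= 1 by rewrite !ltW.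
apply: (le_trans
  (sqrt_lipschitz_derive1 _ _ _ (sqrt_lipschitz_dilation _ u01) x0 _)).
  exact: derH.
by rewrite -mulrA !ler_wpM2l// lef_pV2 ?posrE ?sqrtr_gt0// ler_wsqrtr// ltW.
Qed.

End averaged_dilations.

(** * One-sided derivatives and mean value estimates *)

Lemma derivative_within_continuous (R : realType) (A : set R) (f df : R -> R) :
  (forall x, A x -> is_derivative_within A f x (df x)) ->
  {within A, continuous f}.
Proof.
move=> dA; apply/subspace_continuousP => x Ax; apply/cvgrPdist_lt => e e0.
have : \forall y \near within A x^', `|df x - (f y - f x) / (y - x)| < 1.
  by have /cvgrPdist_lt/(_ _ ltr01) := dA x Ax.
rewrite near_withinE /dnbhs near_withinE => near_q.
pose m := `|df x| + 1.
have m0 : 0 < m by rewrite ltr_wpDl.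
have near_x : \forall y \near x, `|x - y| < e / m.
  by apply/nbhs_ballP; exists (e / m) => //=; rewrite divr_gt0.
change (\forall y \near within A (nbhs x), `|f x - f y| < e).
rewrite near_withinE; near=> y => Ay.
have [->|yx] := eqVneq y x; first by rewrite subrr normr0.
have qy : `|df x - (f y - f x) / (y - x)| < 1.
  by move: yx Ay; near: y.
have xy : `|x - y| < e / m by near: y.
have -> : f x - f y = (f y - f x) / (y - x) * (x - y).
  by field; rewrite subr_eq0.
rewrite normrM mulrC.
have qm : `|(f y - f x) / (y - x)| <= m.
  rewrite -[X in `|X|](subKr (df x)) (le_trans (ler_normB _ _))//.
  by rewrite lerD2l ltW.
rewrite (le_lt_trans (ler_wpM2l _ qm))//.
by rewrite -ltr_pdivlMr.
Unshelve. all: by end_near. Qed.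

Lemma derivative_within_is_derive (R : realType) (A : set R) (f : R -> R)
    (x l : R) :
  nbhs x A -> is_derivative_within A f x l -> is_derive x 1 f l.
Proof.
move=> xA dA.
have {}dA : (f y - f x) / (y - x) @[y --> x^'] --> l.
  move=> U /dA; rewrite /within /= => near_q.
  by apply: filterS2 (nbhs_dnbhs xA) near_q => y Ay; apply.
suff cl : h^-1 *: (f (h *: 1 + x) - f x) @[h --> 0^'] --> l.
  split; first by apply/cvg_ex; exists l.
  exact: cvg_lim cl.
apply/cvgr_dnbhsP => u [u0 cu].
move/cvgr_dnbhsP : dA => /(_ (fun n => u n + x)) dA.
have {}dA : (f (u n + x) - f x) / (u n + x - x) @[n --> \oo] --> l.
  apply: dA; split; first by move=> n; rewrite -subr_eq0 addrK.
  by rewrite -[X in _ --> X]add0r; apply: cvgD => //; exact: cvg_cst.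
apply: cvg_trans dA; apply: near_eq_cvg; apply: nearW => n.
by rewrite addrK [u n *: 1]mulr1 mulrC.
Qed.

(** Cauchy's mean value theorem for [h] against [Num.sqrt], whose derivative at
    [s] is [(2 * Num.sqrt s)^-1]. *)
Lemma derive_sqrt_lipschitz (R : realType) (b C : R) (h dh : R -> R) :
  {within `[0, b], continuous h} ->
  (forall s, s \in `]0, b[ -> is_derive s 1 h (dh s)) ->
  (forall s, s \in `]0, b[ -> `|dh s| <= C / (2 * Num.sqrt s)) ->
  forall x y, x \in `[0, b] -> y \in `[0, b] ->
    `|h x - h y| <= C * `|Num.sqrt x - Num.sqrt y|.
Proof.
move=> ch dhP dhC.
suff lt_case x y : x \in `[0, b] -> y \in `[0, b] -> x < y ->
    `|h x - h y| <= C * `|Num.sqrt x - Num.sqrt y|.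
  move=> x y xb yb; have [xy|yx|->] := ltgtP x y.
  - exact: lt_case.
  - by rewrite distrC [X in _ * X]distrC lt_case.
  - by rewrite !subrr normr0 mulr0.
rewrite !in_itv/= => /andP[x0 xb] /andP[y0 yb] xy.
have sub c : c \in `]x, y[ -> 0 < c < b.
  rewrite in_itv/= => /andP[xc cy].
  by rewrite (le_lt_trans x0 xc) (lt_le_trans cy).
have hc : {within `[x, y], continuous h}.
  apply: continuous_subspaceW ch => z /=; rewrite !in_itv/= => /andP[xz zy].
  by rewrite (le_trans x0 xz) (le_trans zy yb).
have sc : {within `[x, y], continuous (@Num.sqrt R)}.
  by apply: continuous_subspaceT; exact: sqrt_continuous.
have hd c : c \in `]x, y[ -> is_derive c 1 h (dh c).
  by move=> /sub cb; apply: dhP; rewrite in_itv.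
have sd c : c \in `]x, y[ -> is_derive c 1 Num.sqrt (2 * Num.sqrt c)^-1.
  by move=> /sub/andP[c0 _]; exact: is_derive1_sqrt.
have sd0 c : c \in `]x, y[ -> (2 * Num.sqrt c)^-1 != 0.
  move=> /sub/andP[c0 _].
  by rewrite invr_neq0// mulf_neq0// gt_eqF ?sqrtr_gt0.
have [c cxy] := cauchy_MVT xy hc sc hd sd sd0.
move/sub : cxy => cb; have /andP[c0 _] := cb.
rewrite invrK => quotE.
have sxy : Num.sqrt y - Num.sqrt x != 0.
  rewrite subr_eq0 gt_eqF// ltr_sqrt// .
  by rewrite (le_lt_trans x0).
rewrite distrC [X in _ * X]distrC -ler_pdivrMr ?normr_gt0//.
rewrite -normfV -normrM -quotE normrM [X in _ * X]gtr0_norm; last first.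
  by rewrite mulr_gt0 ?sqrtr_gt0.
by rewrite -ler_pdivlMr ?mulr_gt0 ?sqrtr_gt0// dhC// in_itv.
Qed.

(** With [r = Num.sqrt s], [ln s = 2 * ln r] and [`|ln r| <= r + r^-1]. *)
Lemma sqrt_mul_ln_le (R : realType) (s : R) : 0 < s ->
  Num.sqrt s * `|ln s| <= 2 * (s + 1).
Proof.
move=> s0; pose r := Num.sqrt s.
have r0 : 0 < r by rewrite sqrtr_gt0.
have rs : r ^+ 2 = s by rewrite sqr_sqrtr// ltW.
rewrite -/r -rs lnXn// normrMn mulrnAr -mulr_natl ler_wpM2l//.
have ln_le (x : R) : 0 < x -> ln x <= x by move=> x0; exact/ltW/ln_sublinear.
have lnr : `|ln r| <= r + r^-1.
  rewrite ler_norml; apply/andP; split.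
    rewrite lerNl -lnV ?posrE// (le_trans (ln_le _ _)) ?invr_gt0//.
    by rewrite lerDr ltW.
  by rewrite (le_trans (ln_le _ r0))// lerDl invr_ge0 ltW.
by rewrite (le_trans (ler_wpM2l (ltW r0) lnr))// mulrDr mulfV ?gt_eqF// expr2.
Qed.

Lemma expR_sub1_le (R : realType) (x : R) : `|expR x - 1| <= `|x| * expR `|x|.
Proof.
have [x0|x0] := leP 0 x.
  rewrite (ger0_norm x0) ger0_norm; last first.
    by rewrite subr_ge0 -[leLHS]expR0 ler_expR.
  have := expR_ge1Dx (- x); rewrite -(ler_pM2r (expR_gt0 x)) -expRD addNr expR0.
  by rewrite mulrDl mul1r mulNr; lra.
have /ltW x0' := x0.
rewrite (ler0_norm x0') ler0_norm; last by rewrite subr_le0 expR_le1.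
have h1 := expR_ge1Dx x.
have h2 : 1 <= expR (- x) by rewrite -[leLHS]expR0 ler_expR oppr_ge0.
have : - x * 1 <= - x * expR (- x) by rewrite ler_wpM2l// oppr_ge0.
by rewrite mulr1; lra.
Qed.

(** * The factor created by the variable order *)

(** The nearest point of [[0, b]]. Composing with it extends a function on
    [[0, b]] to a function on the line with the same modulus of continuity, so
    that measurability questions can be settled on the whole line. *)
Definition clamp (R : realType) (b s : R) : R := Num.max 0 (Num.min b s).

Lemma clamp_in (R : realType) (b s : R) : 0 <= b -> clamp R b s \in `[0, b].
Proof.
by move=> b0; rewrite /clamp in_itv/= le_max lexx/= ge_max b0 ge_min lexx.
Qed.

Lemma clamp_id (R : realType) (b s : R) : s \in `[0, b] -> clamp R b s = s.
Proof.
by rewrite in_itv/= => /andP[s0 sb]; rewrite /clamp min_r// max_r.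
Qed.

Lemma dist_sqrt_clamp_le (R : realType) (b x y : R) : 0 <= b ->
  `|Num.sqrt (clamp R b x) - Num.sqrt (clamp R b y)| <=
  `|Num.sqrt x - Num.sqrt y|.
Proof.
move=> b0.
have sqrt_clamp (z : R) :
    Num.sqrt (clamp R b z) = Num.min (Num.sqrt b) (Num.sqrt z).
  rewrite /clamp; have [bz|zb] := ltP b z.
    by rewrite max_r// min_l// ler_wsqrtr//; exact: ltW.
  rewrite [in RHS]min_r ?ler_wsqrtr//.
  by have [//|z0] := leP 0 z; rewrite sqrtr0 ler0_sqrtr// ltW.
rewrite !sqrt_clamp.
have [bx|xb] := leP (Num.sqrt b) (Num.sqrt x);
  have [yb|yb] := leP (Num.sqrt b) (Num.sqrt y) => //.
- by rewrite subrr normr0.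
- have yx := le_trans (ltW yb) bx.
  by rewrite !ger0_norm ?lerD2r ?subr_ge0// ltW.
- have xy := le_trans (ltW xb) yb.
  by rewrite distrC [leRHS]distrC !ger0_norm ?lerD2r ?subr_ge0// ltW.
Qed.

Section variable_order.
Context {R : realType}.
Variables (b L : R) (alpha dalpha : R -> R).
Hypothesis hb : 0 < b.
Hypothesis hdiff : forall t, t \in `[0, b] ->
  is_derivative_within `[0, b] alpha t (dalpha t).
Hypothesis hbound : forall t, t \in `[0, b] -> `|dalpha t| <= L.

(** The ratio of [s `^ (- alpha s)] to the constant-order kernel
    [s `^ (- alpha 0)]. At [0] it is [0 `^ 0 = 1], the value that makes it
    continuous. *)
Definition order_defect (s : R) : R := s `^ (alpha 0 - alpha s).

Let L0 : 0 <= L.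
Proof.
have /hbound : 0 \in `[0, b] by rewrite in_itv/= lexx ltW.
exact: le_trans.
Qed.

Let alpha_continuous : {within `[0, b], continuous alpha}.
Proof. exact: derivative_within_continuous hdiff. Qed.

Let alpha_is_derive s : s \in `]0, b[ -> is_derive s 1 alpha (dalpha s).
Proof.
move=> sb; apply: (@derivative_within_is_derive _ `[0, b]).
  by apply: filterS (near_in_itvoo sb) => x; exact: subset_itv_oo_cc.
by apply/hdiff/subset_itv_oo_cc.
Qed.

(** The mean value theorem; this linear vanishing at [0] is what compensates the
    logarithm in [order_defect]. *)
Let dist_alpha0 s : 0 < s <= b -> `|alpha 0 - alpha s| <= L * s.
Proof.
move=> /andP[s0 sb].
have ca : {within `[0, s], continuous alpha}.
  by apply: continuous_subspaceW alpha_continuous; exact: subset_itvl.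
have da x : x \in `]0, s[ -> is_derive x 1 alpha (dalpha x).
  rewrite in_itv/= => /andP[x0 xs]; apply: alpha_is_derive.
  by rewrite in_itv/= x0 (lt_le_trans xs).
have [c] := MVT s0 da ca; rewrite in_itv/= => /andP[c0 cs] E.
rewrite distrC E subr0 normrM (gtr0_norm s0) ler_wpM2r ?(ltW s0)//.
by rewrite hbound// in_itv/= (ltW c0) (le_trans (ltW cs)).
Qed.

(** [N] bounds the exponent of [order_defect] divided by [Num.sqrt s], and [M]
    bounds [order_defect] itself. *)
Let N := L * (2 * (b + 1)).

Let sqrt_le s : 0 < s <= b -> Num.sqrt s <= b + 1.
Proof.
move=> /andP[s0 sb]; have : Num.sqrt s ^+ 2 = s by rewrite sqr_sqrtr// ltW.
have := sqr_ge0 (Num.sqrt s - 1); rewrite sqrrB1 => h1 h2.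
have := sqrtr_ge0 s; lra.
Qed.

Let exponent_le s : 0 < s <= b ->
  `|(alpha 0 - alpha s) * ln s| <= N * Num.sqrt s.
Proof.
move=> sb; have /andP[s0 sb'] := sb.
rewrite normrM (le_trans (ler_wpM2r (normr_ge0 _) (dist_alpha0 _ sb)))//.
have -> : L * s * `|ln s| = L * (Num.sqrt s * (Num.sqrt s * `|ln s|)).
  by rewrite -[X in L * X * _](sqr_sqrtr (ltW s0)); ring.
have -> : N * Num.sqrt s = L * (Num.sqrt s * (2 * (b + 1))) by rewrite /N; ring.
rewrite ler_wpM2l// ler_wpM2l ?sqrtr_ge0//.
by rewrite (le_trans (sqrt_mul_ln_le _ _ s0))// ler_wpM2l// lerD2r.
Qed.

Let M := expR (N * (b + 1)).

Let N0 : 0 <= N.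
Proof. by rewrite mulr_ge0// mulr_ge0// addr_ge0// ltW. Qed.

Let exponent_leM s : 0 < s <= b -> expR `|(alpha 0 - alpha s) * ln s| <= M.
Proof.
move=> sb; rewrite ler_expR (le_trans (exponent_le _ sb))//.
by rewrite ler_wpM2l// sqrt_le.
Qed.

Lemma order_defectE s : 0 < s ->
  order_defect s = expR ((alpha 0 - alpha s) * ln s).
Proof. by move=> s0; rewrite /order_defect /powR gt_eqF. Qed.

Lemma order_defect0 : order_defect 0 = 1.
Proof. by rewrite /order_defect subrr powRr0. Qed.

Let order_defect_is_derive s : s \in `]0, b[ -> is_derive s 1 order_defect
  (order_defect s * ((alpha 0 - alpha s) / s - dalpha s * ln s)).
Proof.
move=> sb; have := sb; rewrite in_itv/= => /andP[s0 _].
have da := alpha_is_derive _ sb.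
have dl := is_derive1_ln s0.
apply: (@near_eq_is_derive _ _ _ (fun x => expR ((alpha 0 - alpha x) * ln x))).
  near=> x; rewrite order_defectE//.
  by near: x; exact: lt_nbhsr.
apply: is_derive_eq.
rewrite order_defectE//.
by congr (_ * _); rewrite /GRing.scale/=; ring.
Unshelve. all: by end_near. Qed.

(** The derivative has a logarithmic singularity only: the difference quotient
    of [alpha] is bounded by [L], and [Num.sqrt s * `|ln s|] is bounded. *)
Let order_defect_derive_le s : s \in `]0, b[ ->
  `|order_defect s * ((alpha 0 - alpha s) / s - dalpha s * ln s)| <=
  (M * L * (6 * (b + 1))) / (2 * Num.sqrt s).
Proof.
rewrite in_itv/= => /andP[s0 sb].
have s0b : 0 < s <= b by rewrite s0 ltW.
have r0 : 0 < Num.sqrt s by rewrite sqrtr_gt0.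
have odM : `|order_defect s| <= M.
  rewrite order_defectE// ger0_norm ?expR_ge0//.
  by rewrite (le_trans _ (exponent_leM _ s0b))// ler_expR ler_norm.
have q1 : `|(alpha 0 - alpha s) / s| <= L.
  by rewrite normrM normfV (gtr0_norm s0) ler_pdivrMr// dist_alpha0.
have q2 : `|dalpha s * ln s| <= L * `|ln s|.
  by rewrite normrM ler_wpM2r// hbound// in_itv/= !ltW.
rewrite ler_pdivlMr ?mulr_gt0// normrM -!mulrA ler_pM//.
apply: (@le_trans _ _ ((L + L * `|ln s|) * (2 * Num.sqrt s))).
  rewrite ler_wpM2r ?mulr_ge0//.
  by rewrite (le_trans (ler_normB _ _))// lerD.
have -> : (L + L * `|ln s|) * (2 * Num.sqrt s) =
  L * (2 * Num.sqrt s + 2 * (Num.sqrt s * `|ln s|)) by ring.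
rewrite ler_wpM2l//.
have := sqrt_mul_ln_le _ _ s0; have := sqrt_le _ s0b; lra.
Qed.

(** Away from [0] continuity is inherited from [alpha]; at [0] the function
    differs from [1] by at most [N * M * Num.sqrt y]. *)
Let order_defect_continuous : {within `[0, b], continuous order_defect}.
Proof.
apply/subspace_continuousP => x; rewrite /= in_itv/= => /andP[x0 xb].
move: x0; rewrite le_eqVlt => /predU1P[<-|x0].
  apply/cvgrPdist_lt => e e0.
  have : N * M * Num.sqrt y @[y --> within `[0, b] (nbhs (0 : R))] -->
      N * M * Num.sqrt 0.
    by apply: cvgMr; apply: cvg_within_filter; exact: sqrt_continuous.
  rewrite sqrtr0 mulr0 => /cvgrPdist_lt/(_ _ e0).
  change ((\forall y \near within `[0, b] (nbhs (0 : R)),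
    `|0 - N * M * Num.sqrt y| < e) ->
    \forall y \near within `[0, b] (nbhs (0 : R)),
    `|order_defect 0 - order_defect y| < e).
  rewrite !near_withinE; apply: filterS => y ye yb; have {ye} := ye yb.
  apply: le_lt_trans; rewrite sub0r normrN.
  move: yb; rewrite /= in_itv/= => /andP[y0 yb].
  move: y0; rewrite le_eqVlt => /predU1P[<-|y0].
    by rewrite subrr sqrtr0 mulr0.
  have yb' : 0 < y <= b by rewrite y0.
  rewrite order_defect0 order_defectE// distrC (le_trans (expR_sub1_le _ _))//.
  rewrite (le_trans _ (ler_norm _))// mulrAC.
  by rewrite ler_pM ?expR_ge0 ?exponent_le ?exponent_leM.
have ca : alpha @ within `[0, b] (nbhs x) --> alpha x.
  move/subspace_continuousP : alpha_continuous; apply.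
  by rewrite /= in_itv/= ltW.
have cl : @ln R @ within `[0, b] (nbhs x) --> ln x.
  by apply: cvg_within_filter; exact: continuous_ln.
rewrite /from_subspace (order_defectE _ x0).
have cE : expR ((alpha 0 - alpha y) * ln y) @[y --> within `[0, b] (nbhs x)]
    --> expR ((alpha 0 - alpha x) * ln x).
  apply: continuous_cvg; first exact: continuous_expR.
  apply: cvgM => //; apply: cvgB => //; exact: cvg_cst.
apply: cvg_trans cE; apply: near_eq_cvg; rewrite near_withinE.
by near=> y => _; rewrite order_defectE//; near: y; exact: lt_nbhsr.
Unshelve. all: by end_near. Qed.

(** [clamp] does not increase distances between square roots, so the estimate
    on [[0, b]] extends to the line. *)
Lemma sqrt_lipschitz_order_defect :
  exists C, sqrt_lipschitz C (fun s => order_defect (clamp R b s)).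
Proof.
exists (M * L * (6 * (b + 1))) => x y.
apply: le_trans (derive_sqrt_lipschitz _ _ _ _ _ order_defect_continuous
  order_defect_is_derive order_defect_derive_le _ _ (clamp_in _ _ _ (ltW hb))
  (clamp_in _ _ _ (ltW hb))) _.
apply: ler_wpM2l; last by apply: dist_sqrt_clamp_le; exact: ltW.
by rewrite !mulr_ge0 ?expR_ge0// addr_ge0// ltW.
Qed.

Lemma derivable_order_defect s : s \in `]0, b[ ->
  derivable (fun s => order_defect (clamp R b s)) s 1.
Proof.
move=> sb.
have d : derivable order_defect s 1.
  by have [] := order_defect_is_derive _ sb.
apply: near_eq_derivable d.
apply: filterS (near_in_itvoo sb) => x xb.
by rewrite clamp_id//; exact: subset_itv_oo_cc.
Qed.

End variable_order.

(** * The convolution with the associated kernel *)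

(** Euler's identity for exponents with sum [1], where the third Gamma factor
    is [Gamma 1 = 1]. *)
Lemma ebeta_reflection (R : realType) (a : R) : 0 < a < 1 ->
  ebeta (1 - a) a = (Gamma a * Gamma (1 - a))%:E.
Proof.
move=> /andP[a0 a1].
have fa : egamma a \is a fin_num by rewrite egamma_fin_num// a0 ltW.
have fa' : egamma (1 - a) \is a fin_num.
  by rewrite egamma_fin_num// subr_gt0 a1 gerBl ltW.
rewrite !GammaE EFinM !fineK// muleC egammaM.
by rewrite (_ : 1 - a + a = 1) ?egamma1 ?mul1e// subrK.
Qed.

(** [w] is the weight produced by the constant-order kernels: its integral is
    the normalising constant of [K]. *)
Section abel_average.
Context {R : realType}.
Local Notation mu := (@lebesgue_measure R).
Variable a : R.
Hypothesis a01 : 0 < a < 1.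

Let w (u : R) : R := u `^ (1 - a - 1) * (1 - u) `^ (a - 1).

Let kappa := Gamma a * Gamma (1 - a).

Let mw : measurable_fun setT w.
Proof.
apply: measurable_funM; first exact: measurable_powR.
apply: (@measurableT_comp _ _ _ _ _ _ (fun y : R => y `^ (a - 1))).
  exact: measurable_powR.
exact: measurable_funB.
Qed.

Let w0 u : 0 <= w u.
Proof. by rewrite mulr_ge0 ?powR_ge0. Qed.

Lemma Gamma_reflection_ge1 : 1 <= Gamma a * Gamma (1 - a).
Proof.
move: (a01) => /andP[a0 a1].
rewrite -lee_fin -ebeta_reflection//; apply: ebeta_ge1; last exact: ltW.
by rewrite gerBl ltW.
Qed.

Lemma integrable_abel_weight : mu.-integrable `]0, 1[ (EFin \o w).
Proof.
apply/integrableP; split; first exact/measurable_EFinP/measurable_funTS.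
under eq_integral do rewrite /= ger0_norm//.
by rewrite [X in (X < _)%E](ebeta_reflection _ _ a01) ltry.
Qed.

Lemma Rintegral_abel_weight : \int[mu]_(u in `]0, 1[) w u = kappa.
Proof.
by rewrite /Rintegral [X in fine X](ebeta_reflection _ _ a01).
Qed.

Lemma measurable_abel_integrand (t : R) (H : R -> R) :
  measurable_fun setT H ->
  measurable_fun setT (fun s : R => (t - s) `^ (a - 1) * (s `^ (- a) * H s)).
Proof.
move=> mH; apply: measurable_funM.
  apply: (@measurableT_comp _ _ _ _ _ _ (fun y : R => y `^ (a - 1))).
    exact: measurable_powR.
  exact: measurable_funB.
by apply: measurable_funM => //; exact: measurable_powR.
Qed.

(** Under [s = t * u] the powers of [t] are [1], [a - 1] and [- a]: they cancel,
    so that [t] survives in the argument of [H] only. *)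
Lemma abel_convolution (H : R -> R) (t : R) : 0 < t -> measurable_fun setT H ->
  (forall s, 0 <= H s) ->
  (\int[mu]_(s in `]0%R, t[) ((t - s) `^ (a - 1) * (s `^ (- a) * H s))%:E =
   \int[mu]_(u in `]0%R, 1%R[) (w u * H (t * u))%:E)%E.
Proof.
move=> t0 mH H0.
have mf := measurable_abel_integrand t H mH.
rewrite (ge0_integral_affine t 0 t0)//; last 2 first.
- by apply/measurable_EFinP; exact: measurable_funTS mf.
- by move=> s _; rewrite lee_fin !mulr_ge0 ?powR_ge0.
have -> : [set x | `]0, t[%classic (t * x + 0)] = `]0, 1[%classic.
  by apply/funext => x; rewrite /= !in_itv/= addr0 pmulr_rgt0// gtr_pMr.
rewrite -ge0_integralZl//; last 3 first.
- apply/measurable_EFinP; apply: measurable_funTS.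
  apply: (measurableT_comp mf (g := fun x => t * x + 0)).
  exact: measurable_funD.
- by move=> s _; rewrite lee_fin !mulr_ge0 ?powR_ge0.
- by rewrite lee_fin ltW.
apply: eq_integral => u; rewrite inE/= in_itv/= => /andP[u0 u1].
rewrite -EFinM addr0; congr EFin.
have -> : t - t * u = t * (1 - u) by rewrite mulrBr mulr1.
rewrite !powRM ?(ltW t0) ?(ltW u0) ?subr_ge0 ?(ltW u1)//.
rewrite /w (_ : 1 - a - 1 = - a); last by ring.
have tt : t * t `^ (a - 1) * t `^ (- a) = 1.
  rewrite -[X in X * _ * _](powRr1 (ltW t0)) -!powRD ?(gt_eqF t0) ?implybT//.
  by rewrite (_ : 1 + (a - 1) + - a = 0) ?powRr0//; ring.
by rewrite -[RHS]mul1r -[X in _ = X * _]tt; ring.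
Qed.

End abel_average.

Theorem theorem2p1 (R : realType) (b : R) (hb : 0 < b)
    (alpha dalpha : R -> R) (L : R)
    (halpha : forall t, t \in `[0, b] -> 0 < alpha t < 1)
    (hdiff : forall t, t \in `[0, b] ->
       is_derivative_within `[0, b] alpha t (dalpha t))
    (hbound : forall t, t \in `[0, b] -> `|dalpha t| <= L) :
  let k := fun t : R => t `^ (- alpha t) in
  let kappa := Gamma (alpha 0) * Gamma (1 - alpha 0) in
  let K := fun t : R => t `^ (alpha 0 - 1) / kappa in
  gSC b k K.
Proof.
move=> k kappa K; pose a := alpha 0.
have a01 : 0 < a < 1 by apply: halpha; rewrite in_itv/= lexx ltW.
have /andP[a0 a1] := a01.
have kappa0 : 0 < kappa := lt_le_trans ltr01 (Gamma_reflection_ge1 _ a01).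
pose H s := order_defect alpha (clamp R b s).
have [C CH] : exists C, sqrt_lipschitz C H.
  exact: (sqrt_lipschitz_order_defect _ _ _ _ hb hdiff hbound).
have mH : measurable_fun setT H.
  by apply: continuous_measurable_fun; exact: sqrt_lipschitz_continuous CH.
have H0 : H 0 = 1 by rewrite /H clamp_id ?order_defect0// in_itv/= lexx ltW.
have Hge0 s : 0 <= H s by exact: powR_ge0.
have kE s : s \in `]0, b[ -> k s = s `^ (- a) * H s.
  move=> sb; rewrite /H clamp_id; last exact: subset_itv_oo_cc.
  move: sb; rewrite in_itv/= => /andP[s0 _].
  rewrite /k /order_defect -powRD ?(gt_eqF s0) ?implybT//.
  by congr (_ `^ _); rewrite /a; ring.
pose w (u : R) : R := u `^ (1 - a - 1) * (1 - u) `^ (a - 1).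
pose G := averaged_dilations w H.
pose g t := kappa^-1 * G t.
have w0 u : 0 <= w u by rewrite mulr_ge0 ?powR_ge0.
have iw := integrable_abel_weight a a01.
have CG := sqrt_lipschitz_averaged_dilations w H C w0 iw CH.
have ik0 : 0 <= kappa^-1 by rewrite invr_ge0 ltW.
have Cg := sqrt_lipschitzZ _ _ _ _ ik0 CG.
have dg t : t \in `]0, b[ -> derivable g t 1.
  move=> tb; apply: derivableM => //.
  apply: (derivable_averaged_dilations w H C w0 iw CH b) => // s sb.
  exact: (derivable_order_defect _ _ _ hdiff s sb).
split.
- have ik : (@lebesgue_measure R).-integrable `]0, b[
      (EFin \o (fun s => s `^ (1 - a - 1) * H s)); last first.
    rewrite /L1; move: ik; apply: eq_integrable => // s; rewrite inE => sb.
    by rewrite /= kE// (_ : 1 - a - 1 = - a)//; ring.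
  apply: (integrable_mul_bounded _ _ _ _ (1 + C * Num.sqrt b)) => //.
  + by apply: integrable_powR => //; rewrite subr_gt0.
  + exact: measurable_funTS.
  + move=> s; rewrite /= in_itv/= => /andP[s0 sb].
    rewrite -[H s](subrK (H 0)) addrC (le_trans (ler_normD _ _))//.
    rewrite H0 normr1 lerD2l -H0 (le_trans (CH _ _))//.
    rewrite ler_wpM2l ?(sqrt_lipschitz_ge0 _ _ CH)// sqrtr0 subr0.
    by rewrite ger0_norm ?sqrtr_ge0// ler_wsqrtr// ltW.
- apply: (integrable_mul_bounded _ _ _ _ `|kappa^-1|) => //.
  exact: integrable_powR.
exists g; split => //.
- apply: continuous_subspaceT; exact: sqrt_lipschitz_continuous Cg.
- exact: L1_derive1_sqrt_lipschitz hb Cg dg.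
(* At [t = 0] every dilate takes the value [H 0 = 1]. *)
- rewrite /g /G /averaged_dilations.
  under eq_Rintegral do rewrite mul0r H0 mulr1.
  by rewrite Rintegral_abel_weight// mulVf// gt_eqF.
apply: aeW => t; rewrite in_itv/= => /andP[t0 tb].
transitivity (\int[@lebesgue_measure R]_(s in `]0%R, t[) ((kappa^-1)%:E *
    ((t - s) `^ (a - 1) * (s `^ (- a) * H s))%:E))%E.
  apply: eq_integral => s; rewrite inE/= in_itv/= => /andP[s0 st].
  rewrite -EFinM kE; last by rewrite in_itv/= s0 (lt_trans st).
  by congr EFin; rewrite /K /a; ring.
rewrite ge0_integralZl//; last 2 first.
- apply/measurable_EFinP; apply: measurable_funTS.
  exact: measurable_abel_integrand.
- by move=> s _; rewrite lee_fin !mulr_ge0 ?powR_ge0.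
rewrite abel_convolution// /g EFinM; congr (_ * _)%E.
rewrite /G /averaged_dilations /Rintegral fineK//.
apply: integrable_fin_num => //.
exact: (integrable_dilation w H C iw CH).
Qed.
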